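(* Let $n\ge1$ be an integer and let $M$ denote either the binomial-setting missing mass $M_{n,0}$ or the Poisson-setting missing mass $M_0(n)$. Then $M$ is sub-gamma on the right tail with variance factor $v_n^+=2\,\mathbb{E}K_{\overline{2}}(n)/n^2$ and scale factor $1/n$: for all $0\le\lambda<n$, $$\log\mathbb{E}\left[e^{\lambda(M-\mathbb{E}M)}\right]\le\frac{v_n^+\lambda^2}{2(1-\lambda/n)}.$$ If moreover the sequence $(\mathbb{E}K_r(n))_{r\ge2}$ is non-increasing, then $M$ is sub-gamma on the right tail with variance factor $v_n^-=2\,\mathbb{E}K_2(n)/n^2$ and scale factor $1/n$: for all $0\le\lambda<n$, $$\log\mathbb{E}\left[e^{\lambda(M-\mathbb{E}M)}\right]\le\frac{v_n^-\lambda^2}{2(1-\lambda/n)}.$$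
   Context: Let $(p_j)_{j\ge1}$ be a probability mass function on the positive integers, and let $U_1,U_2,\dots$ be i.i.d. with $\mathbb{P}(U_i=j)=p_j$. Binomial setting (sample size $n$): $X_{n,j}=\sum_{i=1}^n \mathbb{I}_{\{U_i=j\}}$; $M_{n,0}=\sum_{j\ge1}p_j\mathbb{I}_{\{X_{n,j}=0\}}$. Poisson setting: the sample size is replaced by a Poisson random variable $N(t)$ with mean $t$, independent of $(U_i)$; $X_j(t)=\sum_{i=1}^{N(t)}\mathbb{I}_{\{U_i=j\}}$ (so the $X_j(t)$, $j\ge1$, are independent Poisson with means $tp_j$); $K_r(t)=\sum_{j\ge1}\mathbb{I}_{\{X_j(t)=r\}}$; $K_{\overline{r}}(t)=\sum_{j\ge1}\mathbb{I}_{\{X_j(t)\ge r\}}$; $M_0(t)=\sum_{j\ge1}p_j\mathbb{I}_{\{X_j(t)=0\}}$. The quantities $K_r(n)$, $K_{\overline{2}}(n)$, $M_0(n)$ are these Poisson quantities at $t=n$. *)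

(* Defs.v *)
From HB Require Import structures.
From mathcomp Require Import all_boot all_order all_algebra.
From mathcomp Require Import finmap.
From mathcomp Require Import all_classical all_reals all_analysis.

Set Implicit Arguments.
Unset Strict Implicit.
Unset Printing Implicit Defensive.

Import Order.TTheory GRing.Theory Num.Theory.

Local Open Scope classical_set_scope.
Local Open Scope ring_scope.

(* Only the values [p j] with [1 <= j] matter; [p 0] is unconstrained and never
   used. *)
Definition is_pmf_pos (R : realType) (p : nat -> R) : Prop :=
  (forall j, (1 <= j)%N -> 0 <= p j) /\
  (\sum_(1 <= j <oo) (p j)%:E = 1)%E.

Section independence.
Context d d' (T : measurableType d) (T' : measurableType d') (R : realType).
Variable P : probability T R.

Definition mutually_independent (I : choiceType) (X : I -> {RV P >-> T'}) :
    Prop :=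
  forall (J : {fset I}) (A : I -> set T'), (forall i, measurable (A i)) ->
    (P (\bigcap_(i in [set` J]) (X i @^-1` A i)) =
     \prod_(i <- J) P (X i @^-1` A i))%E.

Definition sigma_of_family (I : Type) (X : I -> {RV P >-> T'}) :
    set (set T) :=
  <<s \bigcup_i preimage_set_system [set: T] (X i) measurable >>.

Definition independent_of_family d'' (T'' : measurableType d'')
    (Y : {RV P >-> T''}) (I : Type) (X : I -> {RV P >-> T'}) : Prop :=
  forall (B : set T'') (E : set T), measurable B -> sigma_of_family X E ->
    (P (Y @^-1` B `&` E) = P (Y @^-1` B) * P E)%E.

End independence.

(* The library's [poisson_pmf t] is the Poisson pmf only for [0 < t]. *)
Definition poisson_distributed d (T : measurableType d) (R : realType)
    (P : probability T R) (t : R) (N : {RV P >-> nat}) : Prop :=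
  forall k : nat, P [set w | N w = k] = (poisson_pmf t k)%:E.

(* The sample is [U 0, U 1, ...], i.e. [U i] stands for $U_{i+1}$. The sample
   size [S] may be random: [cst n] gives the binomial setting, and a Poisson
   variable gives the Poisson setting. *)
Section occupancy.
Context d (T : measurableType d) (R : realType) (P : probability T R).
Variables (U : nat -> T -> nat) (S : T -> nat).

Definition occ (j : nat) (w : T) : nat := (\sum_(i < S w) (U i w == j))%N.

Definition K_eq (r : nat) (w : T) : \bar R :=
  (\sum_(1 <= j <oo) (occ j w == r)%:R%:E)%E.

Definition K_ge (r : nat) (w : T) : \bar R :=
  (\sum_(1 <= j <oo) (r <= occ j w)%N%:R%:E)%E.

Definition missing_mass (p : nat -> R) (w : T) : R :=
  fine (\sum_(1 <= j <oo) (p j * (occ j w == 0%N)%:R)%:E)%E.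

Definition EK_eq (r : nat) : \bar R := (\int[P]_w K_eq r w)%E.

Definition EK_ge (r : nat) : \bar R := (\int[P]_w K_ge r w)%E.

End occupancy.

(* [lambda * c < 1] reads $\lambda < 1/c$, including $c = 0$ where
   $1/c = +\infty$. The logarithm is taken in the extended reals, so that an
   infinite exponential moment violates the bound. *)
Definition sub_gamma_right d (T : measurableType d) (R : realType)
    (P : probability T R) (X : T -> R) (v c : R) : Prop :=
  forall lambda : R, 0 <= lambda -> lambda * c < 1 ->
    (lne ('M_P (fun w => X w - fine 'E_P[X])%R lambda) <=
     (v * lambda ^+ 2 / (2 * (1 - lambda * c)))%:E)%E.

(* Main.v *)
(* Write [B_j] for the event that no observation equals [j], [q_j] for its
   probability and [M = sum_j p_j 1_{B_j}]. In both settings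
   [P (cap_{j in S} B_j) <= prod_{j in S} q_j] and [q_j <= e^{- n p_j}].
   Since [e^{l p_j 1_{B_j}} = 1 + a_j 1_{B_j}] with [a_j >= 0], expanding the
   product over subsets [S] turns the first inequality into
   [E e^{l M} <= prod_j (1 + a_j q_j)], so that
   [log E e^{l (M - E M)} <= sum_j e^{- n p_j} (e^{l p_j} - 1 - l p_j)].
   With [s = l / n], the Poisson law of [X_j(n)] identifies the right-hand side
   with [sum_{r >= 2} s^r E K_r(n)]. If [E K_r(n) <= V] for all [r >= 2], this is
   at most [V s^2 / (1 - s)]; take [V = E K_{>=2}(n)], or [V = E K_2(n)] when the
   sequence is non-increasing. *)

Require Import Defs.
From HB Require Import structures.
From mathcomp Require Import all_boot all_order all_algebra.
From mathcomp Require Import finmap.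
From mathcomp Require Import all_classical all_reals all_analysis.
From mathcomp Require Import measurable_realfun ring lra.

Set Implicit Arguments.
Unset Strict Implicit.
Unset Printing Implicit Defensive.

Import Order.TTheory GRing.Theory Num.Theory.

Local Open Scope classical_set_scope.
Local Open Scope ring_scope.

(** * Power series attached to the Poisson law *)

Lemma expR_nneseries (R : realType) (x : R) : 0 <= x ->
  (\sum_(0 <= k <oo) (x ^+ k / k`!%:R)%:E = (expR x)%:E)%E.
Proof.
move=> x0; rewrite /expR -EFin_lim; last exact: is_cvg_series_exp_coeff.
apply/congr_lim/funext => n /=.
by rewrite /series /exp_coeff /= sumEFin.
Qed.

(** The factor [a ^+ k] merges with [t ^+ k] into an exponential series in [t * a]. Taking [a] as
    the mass outside a finite set of cells makes [a ^+ k] the probability that [k] draws avoid that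
    set. *)
Lemma poisson_pgf (R : realType) (t a : R) : 0 < t -> 0 <= a ->
  (\sum_(0 <= k <oo) (poisson_pmf t k * a ^+ k)%:E =
   (expR (- (t * (1 - a))))%:E)%E.
Proof.
move=> t0 a0; rewrite mulrBr mulr1 opprB addrC expRD EFinM.
have ta0 : 0 <= t * a by rewrite mulr_ge0// ltW.
rewrite -(expR_nneseries (x := t * a))// -nneseriesZl; last first.
  by move=> k _; rewrite lee_fin divr_ge0 ?exprn_ge0.
apply: eq_eseriesr => k _; rewrite -EFinM /poisson_pmf t0 exprMn; congr EFin.
by rewrite mulrAC mulrC; congr (_ * _); rewrite mulrAC.
Qed.

(** Thinning: if each of Poisson(t) many points is kept with probability [a], the number kept is
    Poisson(ta). The binomial coefficient cancels the factorial of [k], which leaves the exponential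
    series of the discarded points, of mean [t * (1 - a)]. *)
Lemma poisson_thinning (R : realType) (t a : R) (r : nat) :
  0 < t -> 0 <= a <= 1 ->
  (\sum_(0 <= k <oo)
     (poisson_pmf t k * ('C(k, r)%:R * a ^+ r * (1 - a) ^+ (k - r)))%:E =
   (expR (- (t * a)) * ((t * a) ^+ r / r`!%:R))%:E)%E.
Proof.
move=> t0 /andP[a0 a1].
have b0 : 0 <= 1 - a by rewrite subr_ge0.
have f0 k : (0 <= (poisson_pmf t k *
    ('C(k, r)%:R * a ^+ r * (1 - a) ^+ (k - r)))%:E)%E.
  by rewrite lee_fin !mulr_ge0 ?exprn_ge0 ?poisson_pmf_ge0.
(* Terms with [k < r] vanish with the binomial coefficient, so the series can be reindexed to start
   at [r]. *)
rewrite (nneseries_split 0 r)// add0n [X in (X + _)%E]big1_seq ?add0e; last first.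
  move=> k; rewrite mem_index_iota => /andP[_ kr].
  by rewrite bin_small// !(mul0r, mulr0).
rewrite -nneseries_addn//.
transitivity (\sum_(0 <= k <oo) ((expR (- t) * ((t * a) ^+ r / r`!%:R))%:E *
    ((t * (1 - a)) ^+ k / k`!%:R)%:E))%E.
  apply: eq_eseriesr => k _; rewrite -EFinM; congr EFin.
  rewrite /poisson_pmf t0 addnK !exprMn exprD.
  have := bin_fact (leq_addl k r); rewrite addnK => /(congr1 (fun i => i%:R : R)).
  rewrite !natrM => <-.
  by field; rewrite ?pnatr_eq0 -!lt0n ?fact_gt0 // bin_gt0 leq_addl.
have tb0 : 0 <= t * (1 - a) by rewrite mulr_ge0// ltW.
rewrite nneseriesZl; last first.
  by move=> k _; rewrite lee_fin divr_ge0 ?exprn_ge0.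
rewrite expR_nneseries// -EFinM mulrAC -expRD; congr (expR _ * _)%:E.
by ring.
Qed.

(** This is the generating function at [s] of a Poisson variable of mean [x], with the terms of
    orders 0 and 1 removed; those two terms are the [1 + s * x] subtracted on the right. *)
Lemma poisson_sum_ge2 (R : realType) (s x : R) : 0 <= s -> 0 <= x ->
  (\sum_(2 <= r <oo) (s ^+ r * (expR (- x) * (x ^+ r / r`!%:R)))%:E =
   (expR (- x) * (expR (s * x) - 1 - s * x))%:E)%E.
Proof.
move=> s0 x0.
have f0 k : (0 <= ((s * x) ^+ k / k`!%:R)%:E)%E.
  by rewrite lee_fin divr_ge0 ?exprn_ge0 ?mulr_ge0.
transitivity ((expR (- x))%:E * \sum_(2 <= k <oo) ((s * x) ^+ k / k`!%:R)%:E)%E.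
  rewrite -nneseriesZl; last by move=> k _; exact: f0.
  apply: eq_eseriesr => k _; rewrite -EFinM; congr EFin.
  by rewrite exprMn mulrCA !mulrA.
rewrite EFinM; congr (_ * _)%E.
have -> : (expR (s * x) - 1 - s * x)%:E = ((expR (s * x))%:E - (1 + s * x)%:E)%E.
  by rewrite -EFinB opprD addrA.
rewrite -expR_nneseries ?mulr_ge0// (nneseries_split 0 2)// add0n.
have -> : (\sum_(0 <= k < 2) ((s * x) ^+ k / k`!%:R)%:E = (1 + s * x)%:E)%E.
  by rewrite /index_iota /= !big_cons big_nil adde0 -EFinD expr0 expr1 !divr1.
by rewrite addeAC subee// add0e.
Qed.

Lemma prodEFin (R : realDomainType) (I : Type) (r : seq I) (Q : pred I)
    (f : I -> R) :
  (\prod_(i <- r | Q i) (f i)%:E = (\prod_(i <- r | Q i) f i)%:E)%E.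
Proof. by rewrite (big_morph _ (@EFinM R) erefl). Qed.

Lemma geometric_tail_le (R : realType) (s : R) : 0 <= s < 1 ->
  (\sum_(2 <= r <oo) (s ^+ r)%:E <= (s ^+ 2 / (1 - s))%:E)%E.
Proof.
move=> /andP[s0 s1]; apply: lime_le.
  by apply: is_cvg_nneseries => r _ _; rewrite lee_fin exprn_ge0.
have b0 : 0 < 1 - s by rewrite subr_gt0.
have geom m : \sum_(2 <= r < m.+2) s ^+ r = (s ^+ 2 - s ^+ m.+2) / (1 - s).
  elim: m => [|m IH]; first by rewrite big_geq// subrr mul0r.
  rewrite big_nat_recr//= IH (exprS _ m.+2).
  by field; rewrite gt_eqF.
(* Sums with upper index 0 or 1 are empty; from 2 on the closed form applies. *)
apply: nearW => -[|[|m]]; rewrite sumEFin lee_fin; last first.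
  rewrite geom ler_pM2r ?invr_gt0// gerBl exprn_ge0//.
all: by rewrite big_geq// divr_ge0 ?exprn_ge0// ltW.
Qed.

(** * Finite disjoint unions, product events and the sigma-algebra of the sample *)

Lemma measure_finType_bigcup d (T : measurableType d) (R : realType)
    (P : probability T R) (I : finType) (Q : pred I) (F : I -> set T) :
  (forall i, Q i -> measurable (F i)) ->
  (forall i j w, F i w -> F j w -> i = j) ->
  (P (\bigcup_(i in [set` Q]) F i) = \sum_(i | Q i) P (F i))%E.
Proof.
move=> mF dF; rewrite measure_fin_bigcup//.
- rewrite [RHS]bigfs ?index_enum_uniq// => i _; by rewrite mem_index_enum.
- by move=> i j _ _ [w [Fi Fj]]; exact: dF Fi Fj.
Qed.

Lemma independent_sample d (T : measurableType d) (R : realType)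
    (P : probability T R) (U : nat -> {RV P >-> nat}) (k : nat)
    (A : 'I_k -> set nat) : mutually_independent U ->
  (P [set w | forall i, A i (U i w)] = \prod_(i < k) P (U i @^-1` A i))%E.
Proof.
move=> ind.
(* Independence is stated for events indexed by all of [nat], so [A] is extended by the full set
   beyond [k]. *)
pose B i := if insub i is Some z then A z else [set: nat].
have BE (i : 'I_k) : B i = A i by rewrite /B valK.
have [J permJ] : exists J : {fset nat}, perm_eq J (index_iota 0 k).
  exists (seq_fset tt (index_iota 0 k)).
  by rewrite (permPl (seq_fset_perm _ _)) undup_id ?iota_uniq.
have := ind J B (fun _ => I); rewrite (perm_big _ permJ) big_mkord.
under [in X in _ = X -> _]eq_bigr do rewrite BE.
move=> <-; congr (P _); apply/seteqP; split => w /= h i.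
  rewrite /= (perm_mem permJ) mem_index_iota /= => ik.
  by rewrite (BE (Ordinal ik)); exact: h.
by rewrite -BE; apply: h; rewrite /= (perm_mem permJ) mem_index_iota /=.
Qed.

(** Carrying the sigma-algebra generated by the sample on a type lets membership in
    [sigma_of_family] be treated as measurability. *)
Local Notation sigma_space U := (g_sigma_algebraType
  (\bigcup_i preimage_set_system [set: _] (U i) measurable)).

Lemma sigma_of_family_sample d (T : measurableType d) (R : realType)
    (P : probability T R) (U : nat -> {RV P >-> nat}) (k : nat)
    (A : 'I_k -> set nat) :
  sigma_of_family U [set w | forall i, A i (U i w)].
Proof.
have -> : [set w | forall i, A i (U i w)] =
    \bigcap_(i in [set: 'I_k]) (U i @^-1` A i).
  by apply/seteqP; split => w /= h i; [move=> _; exact: h|exact: h].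
apply: (@fin_bigcap_measurable _ (sigma_space U)) => // i _.
apply: sub_sigma_algebra; exists (val i) => //.
by exists (A i) => //; rewrite setTI.
Qed.

Lemma sigma_of_family_measurable d (T : measurableType d) (R : realType)
    (P : probability T R) (U : nat -> {RV P >-> nat}) (E : set T) :
  sigma_of_family U E -> measurable E.
Proof.
apply: smallest_sub; first exact: sigma_algebra_measurable.
by move=> A [i _ [B mB <-]]; apply: measurable_funP.
Qed.

Lemma measurable_preimage_nat d (T : measurableType d) (R : realType)
    (P : probability T R) (X : {RV P >-> nat}) (B : set nat) :
  measurable (X @^-1` B).
Proof. exact: measurable_funPTI. Qed.

(** * Laws of the occupancy counts in both settings *)

(** The event splits into the disjoint pieces where [N = k] and [E k] holds. Each [E k] depends on
    the sample only, so independence of [N] factors every piece. All fixed-size results transfer to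
    the Poisson setting this way. *)
Lemma poisson_mixture d (T : measurableType d) (R : realType)
    (P : probability T R) (U : nat -> {RV P >-> nat}) (N : {RV P >-> nat})
    (t : R) (E : nat -> set T) :
  poisson_distributed t N -> independent_of_family N U ->
  (forall k, sigma_of_family U (E k)) ->
  measurable [set w | E (N w) w] /\
  (P [set w | E (N w) w] = \sum_(0 <= k <oo) (poisson_pmf t k)%:E * P (E k))%E.
Proof.
move=> dN iN sE.
have -> : [set w | E (N w) w] = \bigcup_k ((N @^-1` [set k]) `&` E k).
  apply/seteqP; split => [w Ew|w [k _ [/= <-]]//].
  by exists (N w).
have mF k : measurable ((N @^-1` [set k]) `&` E k).
  apply: measurableI; first exact: (measurable_preimage_nat N [set k]).
  exact: sigma_of_family_measurable (sE k).
split; first exact: bigcup_measurable.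
rewrite measure_bigcup//; last by move=> i j _ _ [w [[/= <- _] [/= <- _]]].
transitivity (\sum_(0 <= k <oo) P ((N @^-1` [set k]) `&` E k))%E.
  by apply: eq_eseriesl => k; rewrite in_setT.
by apply: eq_eseriesr => k _; rewrite iN// -dN.
Qed.

(** The pieces are indexed by the set of draws that hit [j]. They are disjoint product events,
    suited both to independence and to counting. *)
Lemma occ_cst_fiber d (T : measurableType d) (R : realType)
    (P : probability T R) (U : nat -> {RV P >-> nat}) (k j r : nat) :
  [set w | occ U (cst k) j w = r] =
  \bigcup_(I in [set` [pred I : {set 'I_k} | #|I| == r]])
    [set w | forall i : 'I_k, [set x | (x == j) = (i \in I)] (U i w)].
Proof.
have occE w : occ U (cst k) j w = #|[set i : 'I_k | U i w == j]%SET|.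
  rewrite /occ /= -sum1_card [RHS]big_mkcond /=.
  by apply: eq_bigr => i _; rewrite inE; case: eqP.
apply/seteqP; split => w /=.
  move=> <-; exists [set i : 'I_k | U i w == j]%SET; rewrite /= ?inE -?occE//.
  by move=> i; rewrite inE.
move=> [I + h]; rewrite /= inE => /eqP <-; rewrite occE; congr #|pred_of_set _|.
by apply/setP => i; rewrite inE h.
Qed.

Lemma sigma_of_family_occ d (T : measurableType d) (R : realType)
    (P : probability T R) (U : nat -> {RV P >-> nat}) (k j r : nat) :
  sigma_of_family U [set w | occ U (cst k) j w = r].
Proof.
rewrite occ_cst_fiber.
apply: (@fin_bigcup_measurable _ (sigma_space U)) => // I _.
exact: (sigma_of_family_sample (fun i => [set x | (x == j) = (i \in I)])).
Qed.

(** Binomial law: every [I] of size [r] has the same probability by independence, and there are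
    ['C(k, r)] of them. *)
Lemma occ_cst_pmf d (T : measurableType d) (R : realType)
    (P : probability T R) (U : nat -> {RV P >-> nat}) (k j r : nat) (a : R) :
  mutually_independent U -> (forall i, P [set w | U i w = j] = a%:E) ->
  P [set w | occ U (cst k) j w = r] =
  ('C(k, r)%:R * a ^+ r * (1 - a) ^+ (k - r))%:E.
Proof.
move=> ind Ua; rewrite occ_cst_fiber measure_finType_bigcup; last first.
- move=> I J w /= hI hJ; apply/setP => i; by rewrite -hI -hJ.
- move=> I _; apply: sigma_of_family_measurable.
  exact: (sigma_of_family_sample (fun i => [set x | (x == j) = (i \in I)])).
transitivity (\sum_(I : {set 'I_k} | #|I| == r)
    (a ^+ r * (1 - a) ^+ (k - r))%:E)%E.
  apply: eq_bigr => I /eqP Ir.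
  rewrite (independent_sample (fun i => [set x | (x == j) = (i \in I)]))//.
  transitivity (\prod_(i < k) (if i \in I then a else 1 - a)%:E)%E.
    apply: eq_bigr => i _.
    have mU : measurable [set w | U i w = j].
      exact: (measurable_preimage_nat (U i) [set j]).
    case: ifPn => [iI|/negbTE iI].
      rewrite -(Ua i); congr (P _); apply/seteqP.
      by split => w /=; [move/eqP|move=> ->; rewrite eqxx].
    rewrite EFinB -(Ua i) -probability_setC//; congr (P _); apply/seteqP.
    by split => w /=; case: eqP.
  rewrite prodEFin (bigID (mem I)) /=; congr (_ * _)%:E.
    by rewrite -Ir -prodr_const; apply: eq_bigr => i ->.
  have -> : (k - r)%N = #|(~: I)%SET| by rewrite cardsCs finset.setCK card_ord Ir.
  rewrite -prodr_const.
  apply: eq_big => [i|i /negbTE -> //]; by rewrite inE.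
have cardI : #|[pred I : {set 'I_k} | #|I| == r]| = 'C(k, r).
  by rewrite -[X in 'C(X, _)]card_ord -card_draws cardsE.
by rewrite sumEFin sumr_const cardI; congr EFin; rewrite -[LHS]mulr_natl mulrA.
Qed.

Lemma sigma_of_family_unoccupied d (T : measurableType d) (R : realType)
    (P : probability T R) (U : nat -> {RV P >-> nat}) (k : nat) (I : finType)
    (S : {set I}) (f : I -> nat) :
  sigma_of_family U
    [set w | forall j, j \in S -> occ U (cst k) (f j) w = 0%N].
Proof.
have -> : [set w | forall j, j \in S -> occ U (cst k) (f j) w = 0%N] =
    \bigcap_(j in [set` S]) [set w | occ U (cst k) (f j) w = 0%N].
  by apply/seteqP; split.
apply: (@fin_bigcap_measurable _ (sigma_space U)) => // j _.
exact: sigma_of_family_occ.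
Qed.

(** All [k] independent draws must avoid the cells [f j]. Injectivity of [f] keeps these cells
    distinct, so their masses add. Later [f] is the successor map, since cells are numbered from
    1. *)
Lemma prob_unoccupied_cst d (T : measurableType d) (R : realType)
    (P : probability T R) (U : nat -> {RV P >-> nat}) (p : nat -> R) (k : nat)
    (I : finType) (S : {set I}) (f : I -> nat) : injective f ->
  mutually_independent U ->
  (forall i j, P [set w | U i w = f j] = (p (f j))%:E) ->
  P [set w | forall j, j \in S -> occ U (cst k) (f j) w = 0%N] =
  ((1 - \sum_(j in S) p (f j)) ^+ k)%:E.
Proof.
move=> finj ind hU.
pose B := \bigcup_(j in [set` S]) [set f j].
have -> : [set w | forall j, j \in S -> occ U (cst k) (f j) w = 0%N] =
    [set w | forall i : 'I_k, (~` B) (U i w)].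
  apply/seteqP; split => w /= h.
    move=> i [j jS /= Uij]; have /eqP := h _ jS.
    by rewrite /occ sum_nat_eq0 => /forallP/(_ i); rewrite Uij eqxx.
  move=> j jS; apply: big1 => i _; case: eqP => // Uij.
  by exfalso; apply: (h i); exists j.
rewrite (independent_sample (fun=> ~` B))//.
transitivity (\prod_(i < k) (1 - \sum_(j in S) p (f j))%:E)%E; last first.
  by rewrite prodEFin prodr_const card_ord.
apply: eq_bigr => i _; rewrite preimage_setC probability_setC; last first.
  exact: (measurable_preimage_nat (U i) B).
rewrite EFinB -sumEFin; congr (_ - _)%E.
transitivity (P (\bigcup_(j in [set` S]) (U i @^-1` [set f j]))); first by [].
rewrite measure_finType_bigcup.
- by apply: eq_bigr => j _; exact: hU.
- by move=> j _; exact: (measurable_preimage_nat (U i) [set f j]).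
- by move=> j j' w /= -> /finj.
Qed.

Lemma prob_unoccupied_poisson d (T : measurableType d) (R : realType)
    (P : probability T R) (U : nat -> {RV P >-> nat}) (N : {RV P >-> nat})
    (t : R) (p : nat -> R) (I : finType) (S : {set I}) (f : I -> nat) :
  0 < t -> injective f -> mutually_independent U ->
  (forall i j, P [set w | U i w = f j] = (p (f j))%:E) ->
  poisson_distributed t N -> independent_of_family N U ->
  P [set w | forall j, j \in S -> occ U N (f j) w = 0%N] =
  (expR (- (t * \sum_(j in S) p (f j))))%:E.
Proof.
move=> t0 finj ind hU dN iN.
have [_ E] := poisson_mixture dN iN
  (fun k => sigma_of_family_unoccupied k S f).
(* The sample size is frozen at [N w] while the sample is evaluated at [w0]; at [w0 = w] this is the
   original event. *)
transitivity (P [set w | [set w0 | forall j, j \in S ->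
  occ U (cst (N w)) (f j) w0 = 0%N] w]); first by [].
(* This number is the probability that a single draw avoids the cells, hence nonnegative. *)
have q0 : 0 <= 1 - \sum_(j in S) p (f j).
  have := prob_unoccupied_cst 1 S finj ind hU.
  by rewrite expr1 -lee_fin => <-.
rewrite E -[X in t * X](subKr 1) -poisson_pgf//; apply: eq_eseriesr => k _.
by rewrite (prob_unoccupied_cst k S finj ind hU) -EFinM.
Qed.

Lemma occ_poisson_pmf d (T : measurableType d) (R : realType)
    (P : probability T R) (U : nat -> {RV P >-> nat}) (N : {RV P >-> nat})
    (t a : R) (j r : nat) :
  0 < t -> mutually_independent U -> (forall i, P [set w | U i w = j] = a%:E) ->
  poisson_distributed t N -> independent_of_family N U ->
  measurable [set w | occ U N j w = r] /\
  P [set w | occ U N j w = r] =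
    (expR (- (t * a)) * ((t * a) ^+ r / r`!%:R))%:E.
Proof.
move=> t0 ind Ua dN iN.
have [mE E] := poisson_mixture dN iN
  (fun k => sigma_of_family_occ k j r).
have a01 : 0 <= a <= 1.
  rewrite -!lee_fin -(Ua 0%N) measure_ge0 probability_le1//.
  exact: (measurable_preimage_nat (U 0%N) [set j]).
split; first exact: mE.
transitivity (P [set w | [set w0 | occ U (cst (N w)) j w0 = r] w]); first by [].
rewrite E -poisson_thinning//; apply: eq_eseriesr => k _.
by rewrite (occ_cst_pmf _ _ ind Ua).
Qed.

(** * Exponential moments of weighted sums of indicators *)

(** Both sides expand into sums over subsets [S] with the same nonnegative coefficients, so the
    bound on joint probabilities applies term by term. *)
Lemma integral_prod_indic_le d (T : measurableType d) (R : realType)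
    (P : probability T R) (I : finType) (B : I -> set T) (a q : I -> R) :
  (forall i, measurable (B i)) -> (forall i, 0 <= a i) ->
  (forall S : {set I},
     P (\bigcap_(i in [set` S]) B i) <= (\prod_(i in S) q i)%:E)%E ->
  (\int[P]_w (\prod_i (1 + a i * \1_(B i) w))%:E <=
   (\prod_i (1 + a i * q i))%:E)%E.
Proof.
move=> mB a0 hB.
have mcap (S : {set I}) : measurable (\bigcap_(i in [set` S]) B i).
  by apply: fin_bigcap_measurable => // i _; exact: mB.
have expand w : ((\prod_i (1 + a i * \1_(B i) w))%:E = \sum_(S : {set I})
    (\prod_(i in S) a i)%:E * (\1_(\bigcap_(i in [set` S]) B i) w)%:E)%E.
  under eq_bigr do rewrite addrC.
  rewrite bigA_distr -sumEFin; apply: eq_bigr => S _.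
  rewrite -big_mkcond /= big_split /= EFinM; congr (_ * _%:E)%E.
  (* A product of indicators is the indicator of the intersection: outside it, some factor is 0. *)
  rewrite indicE; have [h|h] := boolP (w \in _).
    by apply: big1 => i iS; rewrite indicE mem_set//; exact: (set_mem h).
  have [i iS Biw] : exists2 i, i \in S & ~ B i w.
    apply: contra_notP (negP h) => nB; apply/mem_set => i iS.
    by apply: contrapT => nBi; apply: nB; exists i.
  by rewrite (bigD1 i)//= indicE memNset// mul0r.
under eq_integral do rewrite expand.
rewrite ge0_integral_sum//; last 2 first.
- move=> S; apply: emeasurable_funM => //; apply/measurable_EFinP.
  exact: measurable_indic.
- by move=> S w _; rewrite mule_ge0 ?lee_fin ?prodr_ge0.
under [in leRHS]eq_bigr do rewrite addrC.
rewrite bigA_distr -sumEFin; apply: lee_sum => S _.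
rewrite -big_mkcond /= big_split /= EFinM.
rewrite ge0_integralZl_EFin ?prodr_ge0//; last first.
  by apply/measurable_EFinP; exact: measurable_indic.
rewrite integral_indic// setIT; apply: lee_wpmul2l => //.
  by rewrite lee_fin prodr_ge0.
exact: hB.
Qed.

Lemma mgf_sum_indic_le d (T : measurableType d) (R : realType)
    (P : probability T R) (I : finType) (B : I -> set T) (x q : I -> R)
    (l c : R) : 0 <= l ->
  (forall i, measurable (B i)) -> (forall i, 0 <= x i) -> (forall i, 0 <= q i) ->
  (forall S : {set I},
     P (\bigcap_(i in [set` S]) B i) <= (\prod_(i in S) q i)%:E)%E ->
  (\int[P]_w (expR ((\sum_i x i * \1_(B i) w - c) * l))%:E <=
   (expR (\sum_i q i * (expR (l * x i) - 1) - l * c))%:E)%E.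
Proof.
move=> l0 mB x0 q0 hB.
pose a i := expR (l * x i) - 1.
have a0 i : 0 <= a i by rewrite subr_ge0 -expR0 ler_expR mulr_ge0.
have split w : (expR ((\sum_i x i * \1_(B i) w - c) * l))%:E =
    ((expR (- (l * c)))%:E * (\prod_i (1 + a i * \1_(B i) w))%:E)%E.
  rewrite -EFinM mulrC mulrBr expRD mulrC; congr (_ * _)%:E.
  rewrite mulr_sumr expR_sum; apply: eq_bigr => i _; rewrite indicE.
  by case: (w \in B i); rewrite ?mulr1 ?mulr0 ?expR0 ?addr0// /a addrC subrK.
under eq_integral do rewrite split.
rewrite ge0_integralZl_EFin ?expR_ge0//; last 2 first.
- by move=> w _; rewrite lee_fin prodr_ge0// => i _; rewrite addr_ge0// mulr_ge0.
- apply/measurable_EFinP; apply: measurable_prod => i _.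
  apply: measurable_funD => //; apply: measurable_funM => //.
rewrite addrC expRD EFinM lee_wpmul2l ?lee_fin ?expR_ge0//.
apply: le_trans (integral_prod_indic_le mB a0 hB) _.
(* Each factor is bounded by [1 + y <= expR y]. *)
rewrite lee_fin expR_sum; apply: ler_prod => i _.
by rewrite addr_ge0 ?mulr_ge0//= mulrC expR_ge1Dx.
Qed.

Section weighted_sum.
Import numFieldNormedType.Exports.

(** Passage from finite to infinite sums by monotone convergence of the truncated exponentials. *)
Lemma mgf_weighted_indic_le d (T : measurableType d) (R : realType)
    (P : probability T R) (B : nat -> set T) (x q : nat -> R) (M : T -> R)
    (l b : R) : 0 <= l ->
  (forall i, measurable (B i)) -> (forall i, 0 <= x i) ->
  (\sum_(0 <= i <oo) (x i)%:E < +oo)%E ->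
  (forall i, P (B i) = (q i)%:E) ->
  (forall m (S : {set 'I_m}),
     P (\bigcap_(i in [set` S]) B i) <= (\prod_(i in S) q i)%:E)%E ->
  (forall w, M w = fine (\sum_(0 <= i <oo) (x i * \1_(B i) w)%:E)%E) ->
  (forall m, \sum_(i < m) q i * (expR (l * x i) - 1 - l * x i) <= b) ->
  ('M_P (fun w => M w - fine 'E_P[M])%R l <= (expR b)%:E)%E.
Proof.
move=> l0 mB x0 xfin Bq hB ME hb.
have q0 i : 0 <= q i by rewrite -lee_fin -Bq.
have xi0 i w : (0 <= (x i * \1_(B i) w)%:E)%E by rewrite lee_fin mulr_ge0.
have xile i w : ((x i * \1_(B i) w)%:E <= (x i)%:E)%E.
  by rewrite lee_fin ler_piMr// indicE; case: (w \in _).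
have mxi i : measurable_fun [set: T] (fun w => (x i * \1_(B i) w)%:E).
  by apply/measurable_EFinP; apply: measurable_funM.
have MEs w : (M w)%:E = (\sum_(0 <= i <oo) (x i * \1_(B i) w)%:E)%E.
  rewrite ME fineK// ge0_fin_numE; last by apply: nneseries_ge0 => i _ _.
  by apply: le_lt_trans xfin; apply: lee_nneseries => i *.
have EM : ('E_P[M] = \sum_(0 <= i <oo) (x i * q i)%:E)%E.
  rewrite expectation.unlock; under eq_integral do rewrite MEs.
  rewrite integral_nneseries//; apply: eq_eseriesr => i _.
  under eq_integral do rewrite EFinM.
  rewrite ge0_integralZl_EFin//; last by apply/measurable_EFinP.
  by rewrite integral_indic// setIT EFinM -Bq.
set c := fine _.
(* Every truncation is centred at the full mean [c], which keeps the exponentials nondecreasing in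
   [m]. As [c] dominates each truncated mean, the finite bound with linear term removed still
   holds. *)
have cge m : \sum_(i < m) x i * q i <= c.
  rewrite -lee_fin /c fineK; last first.
    rewrite EM ge0_fin_numE; last first.
      by apply: nneseries_ge0 => i _ _; rewrite lee_fin mulr_ge0.
    apply: le_lt_trans xfin; apply: lee_nneseries => i *.
      by rewrite lee_fin mulr_ge0.
    by rewrite lee_fin ler_piMr// -lee_fin -Bq probability_le1.
  rewrite EM -(big_mkord xpredT (fun i => x i * q i)) -sumEFin.
  by apply: nneseries_lim_ge => i _ _; rewrite lee_fin mulr_ge0.
pose g m w := (expR ((\sum_(i < m) x i * \1_(B i) w - c) * l))%:E.
have gcvg w : g m w @[m --> \oo] --> (expR ((M w - c) * l))%:E.
  have : (\sum_(0 <= i < m) (x i * \1_(B i) w)%:E)%E @[m --> \oo] --> (M w)%:E.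
    by rewrite MEs; apply: is_cvg_nneseries => i _ _.
  move=> /fine_cvg cM.
  apply: cvg_EFin; first by apply: nearW.
  have cf : (\sum_(i < m) x i * \1_(B i) w - c) * l @[m --> \oo] -->
      (M w - c) * l.
    apply: cvgMl; apply: cvgB; last exact: cvg_cst.
    apply: cvg_trans cM; apply: near_eq_cvg; apply: nearW => m /=.
    by rewrite sumEFin big_mkord.
  exact: (cvg_comp _ expR cf (@continuous_expR R _)).
have -> : ('M_P (fun w => M w - c)%R l = \int[P]_w limn (g ^~ w))%E.
  rewrite /mmt_gen_fun expectation.unlock; apply: eq_integral => w _.
  by rewrite (cvg_lim _ (gcvg w)).
have mg m : measurable_fun [set: T] (g m).
  apply/measurable_EFinP; apply: measurableT_comp => //.
  apply: measurable_funM => //; apply: measurable_funB => //.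
  by apply: measurable_sum => i; apply: measurable_funM.
rewrite monotone_convergence//; last 2 first.
- by move=> m w _; rewrite lee_fin expR_ge0.
- move=> w _ m n mn; rewrite lee_fin ler_expR ler_wpM2r// lerB//.
  rewrite -!(big_mkord xpredT (fun i => x i * \1_(B i) w)).
  by rewrite -lee_fin -!sumEFin; apply: lee_sum_nneg_natr.
apply: lime_le.
  apply: ereal_nondecreasing_is_cvgn => m n mn; apply: ge0_le_integral => //.
  - by move=> w _; rewrite lee_fin expR_ge0.
  - move=> w _; rewrite lee_fin ler_expR ler_wpM2r// lerB//.
    rewrite -!(big_mkord xpredT (fun i => x i * \1_(B i) w)).
    by rewrite -lee_fin -!sumEFin; apply: lee_sum_nneg_natr.
apply: nearW => m.
apply: le_trans (mgf_sum_indic_le _ l0 _ _ _ (hB m)) _ => //.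
rewrite lee_fin ler_expR; apply: le_trans (hb m).
under [leRHS]eq_bigr do rewrite mulrBr.
rewrite sumrB lerB//.
apply: le_trans (ler_wpM2l l0 (cge m)).
by rewrite mulr_sumr; apply: ler_sum => i _; rewrite [leLHS]mulrC mulrA.
Qed.

End weighted_sum.

(** * Expected occupancy counts *)

Lemma nneseries_shift1 (R : realType) (f : nat -> \bar R) :
  (forall i, 0 <= f i.+1)%E ->
  (\sum_(1 <= j <oo) f j = \sum_(0 <= i <oo) f i.+1)%E.
Proof.
(* The value [f 0] may be negative; [g] replaces it by 0 without changing the sum from 1. *)
move=> f0; pose g j := if j is i.+1 then f i.+1 else 0%E.
transitivity (\sum_(1 <= j <oo) g j)%E.
  by apply/congr_lim/funext => m; apply: eq_big_nat => -[].
rewrite -nneseries_addn; last by case.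
by apply: eq_eseriesr => i _; rewrite addn1.
Qed.

Lemma integral_count d (T : measurableType d) (R : realType)
    (P : probability T R) (e : nat -> T -> bool) :
  (forall i, measurable [set w | e i.+1 w]) ->
  (\int[P]_w (\sum_(1 <= j <oo) (e j w)%:R%:E) =
   \sum_(0 <= i <oo) P [set w | e i.+1 w])%E.
Proof.
move=> me.
have eE i w : (e i.+1 w)%:R = \1_[set w | e i.+1 w] w :> R.
  rewrite indicE; have [h|/negP h] := boolP (e i.+1 w); first by rewrite mem_set.
  by rewrite memNset.
under eq_integral => w _ do
  (rewrite nneseries_shift1; last by move=> i; rewrite lee_fin ler0n).
rewrite integral_nneseries//.
- apply: eq_eseriesr => i _; under eq_integral do rewrite eE.
  by rewrite integral_indic// setIT.
- move=> i; apply/measurable_EFinP; under eq_fun do rewrite eE.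
  exact: measurable_indic.
Qed.

Lemma EK_eq_series d (T : measurableType d) (R : realType)
    (P : probability T R) (U : nat -> T -> nat) (S : T -> nat) (r : nat) :
  (forall i, measurable [set w | occ U S i.+1 w = r]) ->
  (EK_eq P U S r = \sum_(0 <= i <oo) P [set w | occ U S i.+1 w = r])%E.
Proof.
move=> mE.
have setE i : [set w | occ U S i.+1 w == r] = [set w | occ U S i.+1 w = r].
  by apply/seteqP; split => w /= /eqP.
rewrite /EK_eq /K_eq (integral_count P (e := fun j w => occ U S j w == r)).
  by apply: eq_eseriesr => i _; rewrite setE.
by move=> i; rewrite setE.
Qed.

(** A count of at least 2 is in particular nonzero, which has probability at most [x i], a summable
    bound. Finiteness ensures that [fine] in the variance factor returns the true expectation. *)
Lemma EK_ge2_bounds d (T : measurableType d) (R : realType)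
    (P : probability T R) (U : nat -> T -> nat) (S : T -> nat) (x : nat -> R) :
  (forall i r, measurable [set w | occ U S i.+1 w = r]) ->
  (forall i, (1 - x i)%:E <= P [set w | occ U S i.+1 w = 0%N])%E ->
  (\sum_(0 <= i <oo) (x i)%:E < +oo)%E ->
  (EK_ge P U S 2 < +oo)%E /\
  forall r, (2 <= r)%N -> (EK_eq P U S r <= EK_ge P U S 2)%E.
Proof.
move=> mE hP xfin.
have m2 i : measurable [set w | (2 <= occ U S i.+1 w)%N].
  have -> : [set w | (2 <= occ U S i.+1 w)%N] =
      \bigcup_(r in [set r | (2 <= r)%N]) [set w | occ U S i.+1 w = r].
    apply/seteqP; split => [w /= h|w [r /= + ->]//].
    by exists (occ U S i.+1 w).
  by apply: bigcup_measurable => r _; exact: mE.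
rewrite /EK_ge /K_ge (integral_count P (e := fun j w => (2 <= occ U S j w)%N))//.
split.
  apply: le_lt_trans xfin; apply: lee_nneseries => i *; first exact: measure_ge0.
  apply: le_trans (_ : (P (~` [set w | occ U S i.+1 w = 0%N]) <= _)%E).
    apply: le_measure; rewrite ?inE//; first by apply: measurableC; exact: mE.
    by move=> w /= + h; rewrite h.
  rewrite probability_setC//; apply: (@le_trans _ _ (1 - (1 - x i)%:E)%E).
    by rewrite leeD2l// leeN2.
  by rewrite -EFinB lee_fin opprB addrC subrK.
move=> r r2; rewrite EK_eq_series//; apply: lee_nneseries => i *.
  exact: measure_ge0.
by apply: le_measure; rewrite ?inE// => w /= ->.
Qed.

(** * Product inequality, tail bound and the sub-gamma conclusion *)

(** Weierstrass product inequality. Its [n]-th power is the joint bound for empty cells in the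
    binomial setting. The induction carries along that the product lies in [0, 1], since its step
    uses the upper bound 1. *)
Lemma one_sub_sum_le_prod (R : realDomainType) (I : finType) (x : I -> R)
    (S : {set I}) : (forall i, 0 <= x i <= 1) ->
  1 - \sum_(i in S) x i <= \prod_(i in S) (1 - x i).
Proof.
move=> x01.
have : 0 <= \prod_(i in S) (1 - x i) <= 1 /\
    1 - \sum_(i in S) x i <= \prod_(i in S) (1 - x i); last by case.
elim/big_rec2: _ => [|i y z _ [/andP[z0 z1] yz]].
  by rewrite subr0 lexx ler01.
have /andP[xi0 xi1] := x01 i.
split; first by apply/andP; split; nra.
nra.
Qed.

(** Each summand is a power series in [s] with Poisson probabilities as coefficients. After
    exchanging the sums, the coefficient of [s ^+ r] is a partial sum of the series for the expected
    [K_eq r], hence at most [V], and a geometric series remains. *)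
Lemma sum_expR_tail_le d (T : measurableType d) (R : realType)
    (P : probability T R) (U : nat -> T -> nat) (S : T -> nat) (x : nat -> R)
    (s V : R) (m : nat) :
  (forall i r, measurable [set w | occ U S i.+1 w = r]) ->
  (forall i r, P [set w | occ U S i.+1 w = r] =
     (expR (- x i) * (x i ^+ r / r`!%:R))%:E) ->
  (forall i, 0 <= x i) -> 0 <= s < 1 ->
  (forall r, (2 <= r)%N -> (EK_eq P U S r <= V%:E)%E) ->
  \sum_(i < m) expR (- x i) * (expR (s * x i) - 1 - s * x i) <=
    V * (s ^+ 2 / (1 - s)).
Proof.
move=> mE hP x0 s01 hV; have /andP[s0 s1] := s01.
have t0 i r : 0 <= s ^+ r * (expR (- x i) * (x i ^+ r / r`!%:R)).
  by rewrite !mulr_ge0 ?exprn_ge0 ?expR_ge0// invr_ge0.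
have partial r : (2 <= r)%N ->
    (\sum_(i < m) (expR (- x i) * (x i ^+ r / r`!%:R))%:E <= V%:E)%E.
  move=> r2; apply: le_trans (hV _ r2); rewrite EK_eq_series//.
  under eq_bigr do rewrite -hP.
  rewrite -(big_mkord xpredT (fun i => P [set w | occ U S i.+1 w = r])).
  by apply: nneseries_lim_ge => i _ _; exact: measure_ge0.
have V0 : 0 <= V.
  rewrite -lee_fin; apply: le_trans (partial 2 isT); apply: sume_ge0 => i _.
  by rewrite -hP measure_ge0.
rewrite -lee_fin -sumEFin.
under eq_bigr do rewrite -poisson_sum_ge2//.
rewrite -nneseries_sum; last by move=> i r _; rewrite lee_fin.
apply: (@le_trans _ _ (\sum_(2 <= r <oo) V%:E * (s ^+ r)%:E)%E).
  apply: lee_lim.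
  - by apply: is_cvg_nneseries => r _ _; apply: sume_ge0 => i _; rewrite lee_fin.
  - apply: is_cvg_nneseries => r _ _.
    by rewrite -EFinM lee_fin mulr_ge0 ?exprn_ge0.
  apply: nearW => k; rewrite big_nat_cond [leRHS]big_nat_cond.
  apply: lee_sum => r /andP[/andP[r2 _] _].
  under eq_bigr do rewrite EFinM.
  rewrite -ge0_sume_distrr; last by move=> i _; rewrite -hP measure_ge0.
  by rewrite muleC lee_wpmul2r ?partial// lee_fin exprn_ge0.
rewrite nneseriesZl; last by move=> r _; rewrite lee_fin exprn_ge0.
by rewrite EFinM lee_wpmul2l ?lee_fin ?geometric_tail_le.
Qed.

(** The setting enters only through [q] and the joint bound on empty cells. The last hypothesis is
    about Poisson weights alone, which is why Poisson counts control the binomial missing mass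
    too. *)
Lemma missing_mass_sub_gamma d (T : measurableType d) (R : realType)
    (P : probability T R) (U : nat -> T -> nat) (S : T -> nat) (p q : nat -> R)
    (n : nat) (V : R) : (0 < n)%N -> is_pmf_pos p ->
  (forall i, measurable [set w | occ U S i.+1 w = 0%N]) ->
  (forall i, P [set w | occ U S i.+1 w = 0%N] = (q i)%:E) ->
  (forall i, q i <= expR (- (n%:R * p i.+1))) ->
  (forall m (J : {set 'I_m}),
     P [set w | forall i, i \in J -> occ U S i.+1 w = 0%N] <=
     (\prod_(i in J) q i)%:E)%E ->
  (forall s m, 0 <= s < 1 -> \sum_(i < m) expR (- (n%:R * p i.+1)) *
     (expR (s * (n%:R * p i.+1)) - 1 - s * (n%:R * p i.+1)) <=
     V * (s ^+ 2 / (1 - s))) ->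
  sub_gamma_right P (missing_mass U S p) (2 * V / n%:R ^+ 2) n%:R^-1.
Proof.
move=> n0 [p0 p1] mB Bq qle hB hV l l0 ln.
have nR0 : 0 < n%:R :> R by rewrite ltr0n.
have s01 : 0 <= l / n%:R < 1 by rewrite divr_ge0.
have -> : 2 * V / n%:R ^+ 2 * l ^+ 2 / (2 * (1 - l / n%:R)) =
    V * ((l / n%:R) ^+ 2 / (1 - l / n%:R)).
  by field; rewrite !gt_eqF// subr_gt0; move: ln; rewrite ltr_pdivrMr// mul1r.
set b := (X in (_ <= X%:E)%E).
have expb : (expeR b%:E = (expR b)%:E)%E by [].
have M0 : (0 <= 'M_P (fun w => missing_mass U S p w -
    fine 'E_P[missing_mass U S p])%R l)%E.
  rewrite /mmt_gen_fun expectation.unlock; apply: integral_ge0 => w _.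
  by rewrite lee_fin expR_ge0.
(* Writing [b] as a logarithm reduces the claim to bounding the exponential moment by [expR b]. *)
rewrite -(expeRK b%:E) expb lee_lne ?in_itv/= ?andbT ?leey ?lee_fin ?expR_ge0//.
have indE i w : (occ U S i.+1 w == 0%N)%:R =
    \1_[set w | occ U S i.+1 w = 0%N] w :> R.
  rewrite indicE; have [h|h] := eqVneq (occ U S i.+1 w) 0%N.
    by rewrite mem_set.
  by rewrite memNset//; apply/eqP.
apply: (mgf_weighted_indic_le (B := fun i => [set w | occ U S i.+1 w = 0%N])
  (x := fun i => p i.+1) (q := q)) => //.
- by move=> i; exact: p0.
- rewrite -(nneseries_shift1 (f := fun j => (p j)%:E)) ?p1 ?ltry// => i.
  by rewrite lee_fin p0.
- move=> w; rewrite /missing_mass nneseries_shift1; last first.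
    by move=> i; rewrite lee_fin mulr_ge0 ?p0.
  by congr fine; apply: eq_eseriesr => i _; rewrite indE.
(* Replacing [q i] by the larger exponential is allowed because its factor [expR y - 1 - y] is
   nonnegative. *)
- move=> m; apply: le_trans (hV _ m s01); apply: ler_sum => i _.
  rewrite mulrA divfK ?gt_eqF// ler_wpM2r//.
  by rewrite -addrA -opprD subr_ge0 expR_ge1Dx.
- by rewrite M0.
Qed.

Theorem theorem3p9 (R : realType) (d : measure_display) (T : measurableType d)
    (P : probability T R) (p : nat -> R) (U : nat -> {RV P >-> nat})
    (N : {RV P >-> nat}) (n : nat)
    (hn : (1 <= n)%N)
    (hp : is_pmf_pos p)
    (hU : forall i j : nat, (1 <= j)%N -> P [set w | U i w = j] = (p j)%:E)
    (hUind : mutually_independent U)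
    (hN : poisson_distributed n%:R N)
    (hNU : independent_of_family N U)
    (M : T -> R)
    (hM : M = missing_mass U (cst n) p \/ M = missing_mass U N p) :
  sub_gamma_right P M (2 * fine (EK_ge P U N 2) / n%:R ^+ 2) (n%:R)^-1 /\
  ((forall r s : nat, (2 <= r)%N -> (r <= s)%N ->
      (EK_eq P U N s <= EK_eq P U N r)%E) ->
   sub_gamma_right P M (2 * fine (EK_eq P U N 2) / n%:R ^+ 2) (n%:R)^-1).
Proof.
have [p0 p1] := hp.
have nR0 : 0 < n%:R :> R by rewrite ltr0n.
have pS i : 0 <= p i.+1 by exact: p0.
have x0 i : 0 <= n%:R * p i.+1 by rewrite mulr_ge0.
have hUS i k : P [set w | U k w = i.+1] = (p i.+1)%:E by exact: hU.
have pS1 i : p i.+1 <= 1.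
  rewrite -lee_fin -(hUS i 0%N) probability_le1//.
  exact: (measurable_preimage_nat (U 0%N) [set i.+1]).
have xfin : (\sum_(0 <= i <oo) (n%:R * p i.+1)%:E < +oo)%E.
  under eq_eseriesr do rewrite EFinM.
  rewrite nneseriesZl; last by move=> i _; rewrite lee_fin.
  by rewrite -(nneseries_shift1 (f := fun j => (p j)%:E))// p1 mule1 ltry.
have occN i r := occ_poisson_pmf r nR0 hUind (hUS i) hN hNU.
have mE i r : measurable [set w | occ U N i.+1 w = r] by case: (occN i r).
have PE i r := (occN i r).2.
have PE0 i : P [set w | occ U N i.+1 w = 0%N] = (expR (- (n%:R * p i.+1)))%:E.
  by rewrite PE expr0 divr1 mulr1.
(* Both claims follow from this one, with two choices of the uniform bound [V]. *)
have sub_gamma V :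
    (forall r, (2 <= r)%N -> (EK_eq P U N r <= V%:E)%E) ->
    sub_gamma_right P M (2 * V / n%:R ^+ 2) n%:R^-1.
  move=> hV; case: hM => ->.
  - apply: (missing_mass_sub_gamma (q := fun i => (1 - p i.+1) ^+ n)) => //.
    + move=> i; apply: sigma_of_family_measurable; exact: sigma_of_family_occ.
    + move=> i; rewrite (occ_cst_pmf _ _ hUind (hUS i)).
      by rewrite bin0 expr0 subn0 !mul1r.
    + move=> i; rewrite -mulrN mulrC expRM_natr.
      by rewrite lerXn2r ?nnegrE ?expR_ge0 ?subr_ge0// expR_ge1Dx.
    + move=> m J.
      have Si : injective (fun i : 'I_m => i.+1) by move=> i j [/val_inj].
      have hUJ k (i : 'I_m) := hUS i k.
      (* Sample size 1 shows that [1 - \sum_(i in J) p i.+1] is nonnegative, so that raising to the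
         power [n] preserves the inequality. *)
      have := prob_unoccupied_cst 1 J Si hUind hUJ.
      rewrite expr1 => E1.
      rewrite (prob_unoccupied_cst n J Si hUind hUJ).
      rewrite lee_fin prodrXl lerXn2r ?nnegrE//.
      * by rewrite -lee_fin -E1.
      * by apply: prodr_ge0 => i _; rewrite subr_ge0.
      * by apply: one_sub_sum_le_prod => i; rewrite pS pS1.
    + by move=> s m s01; apply: sum_expR_tail_le PE _ s01 hV.
  - apply: (missing_mass_sub_gamma
      (q := fun i => expR (- (n%:R * p i.+1)))) => //.
    + move=> m J.
      have Si : injective (fun i : 'I_m => i.+1) by move=> i j [/val_inj].
      have hUJ k (i : 'I_m) := hUS i k.
      (* Here the joint bound is an equality: the exponential of the sum factors. *)
      rewrite (prob_unoccupied_poisson J nR0 Si hUind hUJ hN hNU).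
      by rewrite lee_fin mulr_sumr -sumrN expR_sum.
    + by move=> s m s01; apply: sum_expR_tail_le PE _ s01 hV.
have [Kfin Kle] : (EK_ge P U N 2 < +oo)%E /\
    forall r, (2 <= r)%N -> (EK_eq P U N r <= EK_ge P U N 2)%E.
  apply: EK_ge2_bounds mE _ xfin => i.
  by rewrite PE0 lee_fin expR_ge1Dx.
have K0 : (0 <= EK_eq P U N 2)%E.
  by rewrite EK_eq_series//; apply: nneseries_ge0 => i _ _; exact: measure_ge0.
split.
  apply: sub_gamma => r r2; rewrite fineK; first exact: Kle.
  by rewrite ge0_fin_numE//; apply: le_trans K0 (Kle 2%N isT).
(* Now [V] is the expected [K_eq 2], finite because it is dominated by the expected [K_ge 2]. *)
move=> Kdecr; apply: sub_gamma => r r2; rewrite fineK; first exact: Kdecr.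
by rewrite ge0_fin_numE//; apply: le_lt_trans (Kle 2%N isT) Kfin.
Qed.
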